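(* There exists a weighted-rank polyregular map ($\mathsf{WRP}$ map) $Z\colon\{U,D\}^*\rightharpoonup\{U,D\}^*$ such that every Dyck path lies in $\operatorname{dom}(Z)$ and $Z(P)=\zeta(P)$ for every Dyck path $P\in\mathcal D$, where $\zeta$ is the Haglund zeta map. On the other hand, no polyregular map agrees with $\zeta$ on every Dyck path: there is no polyregular map $T\colon\{U,D\}^*\rightharpoonup\{U,D\}^*$ with $\mathcal D\subseteq\operatorname{dom}(T)$ and $T(P)=\zeta(P)$ for all $P\in\mathcal D$.
   Context: **Dyck paths.** A Dyck path of semilength $n$ is a word $P\in\{U,D\}^{2n}$ with $n$ letters $U$ and $n$ letters $D$ such that every prefix has at least as many $U$'s as $D$'s. $\mathcal D_n$ is the set of these, $\mathcal D=\bigcup_{n\ge0}\mathcal D_n$. For a word $w\in\{U,D\}^*$, $h_w(k)$ is the number of $U$'s minus the number of $D$'s among its first $k$ letters. If $P\in\mathcal D_n$ has its $U$'s at positions $p_1<\dots<p_n$, its area sequence is $(a_1,\dots,a_n)$ with $a_i=h_P(p_i-1)$. **Zeta map.** $\zeta(\varepsilon)=\varepsilon$. For $P\in\mathcal D_n$, $n\ge1$, with area sequence $(a_1,\dots,a_n)$, $\zeta(P)$ is the word produced as follows: for each level $r=0,1,\dots,\max_i a_i+1$ in turn, scan $a_1,\dots,a_n$ from left to right and at each $i$ append $U$ if $a_i=r$, append $D$ if $a_i=r-1$, and append nothing otherwise. **MSO on words.** A word $w=a_1\cdots a_n$ over a finite alphabet $\Sigma$ is a structure with universe $\mathrm{Pos}(w)=\{1,\dots,n\}$,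 the order $<$, and unary predicates $P_a$ ($a\in\Sigma$) with $P_a(i)$ iff $a_i=a$. MSO formulas are built from $x<y$, $x=y$, $P_a(x)$, $x\in X$ by Boolean connectives and quantification over positions and over sets of positions. $w\models\varphi(i_1,\dots,i_k)$ denotes satisfaction. **Polyregular maps.** A polyregular presentation (input alphabet $\Sigma$, output alphabet $\Gamma$, both finite) consists of: a nonempty finite set $C$ of copy names, each $c\in C$ with an arity $k_c\ge1$; an MSO domain sentence $\varphi_{\mathrm{dom}}$; for each $c$ an MSO selection formula $\varphi_c(x_1,\dots,x_{k_c})$, giving the set of selected atoms $\mathrm{At}(w)=\{(c,\bar i):c\in C,\ \bar i\in\mathrm{Pos}(w)^{k_c},\ w\models\varphi_c(\bar i)\}$; for each $c$ and $\gamma\in\Gamma$ an MSO label formula $\psi_{c,\gamma}(x_1,\dots,x_{k_c})$ such that each selected atom $(c,\bar i)$ satisfies exactly one of them, that $\gamma$ being its label; and for each pair $c,c'\in C$ an MSO ordering formula $\chi_{c,c'}(\bar x,\bar y)$, such that on each $w$ these define a strict linear order $\chi$ on $\mathrm{At}(w)$. It determines the partial map $f\colon\Sigma^*\rightharpoonup\Gamma^*$ with domain $\{w:w\models\varphi_{\mathrm{dom}}\}$ whose value $f(w)$ is the concatenation of the labels of the selected atoms listed in increasing $\chi$-order. A partial map is polyregular if it is determined by some such presentation. **Rank functions.** A $d$-dimensional deterministic additive rank source over $\Sigma$ is $A=(Q,q_0,\delta,\omega)$ with $Q$ a finite set, $q_0\in Q$, $\delta\colon Q\times\Sigma\to Q$,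 $\omega\colon Q\times\Sigma\to\mathbb Z^d$. On $w=a_1\cdots a_n$ put $q_i=\delta(q_{i-1},a_i)$; for $1\le i\le n+1$ the prefix rank is $\rho_A^w(i)=\sum_{j<i}\omega(q_{j-1},a_j)$, and $q^A_i:=q_{i-1}$ is the state just before position $i$. A $d$-dimensional prefix-additive rank function on $k$-tuples of positions is a function of the form $\kappa^w(x_1,\dots,x_k)=c_0+\sum_{r=1}^k\bigl(\rho_{A_r}^w(x_r)+\beta_r(q^{A_r}_{x_r},a_{x_r})\bigr)$, with $c_0\in\mathbb Z^d$ fixed, $A_r$ fixed $d$-dimensional rank sources with state sets $Q_r$, and $\beta_r\colon Q_r\times\Sigma\to\mathbb Z^d$ fixed tables. **WRP.** A $\mathsf{WRP}$ presentation is a polyregular presentation together with a fixed $d\ge0$ and, for each $c\in C$, a $d$-dimensional prefix-additive rank function $\kappa_c$ on $k_c$-tuples. Selected atoms are ordered by $(c,\bar i)\prec(c',\bar i')$ iff $\kappa_c^w(\bar i)<_{\mathrm{lex}}\kappa_{c'}^w(\bar i')$, or these vectors are equal and $(c,\bar i)$ precedes $(c',\bar i')$ in $\chi$. The associated map has domain $\{w:w\models\varphi_{\mathrm{dom}}\}$ and value the concatenation of the labels of the selected atoms in increasing $\prec$-order. $\mathsf{WRP}$ is the class of partial maps $\Sigma^*\rightharpoonup\Gamma^*$ so obtained. *)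

(* Defs.v *)
From HB Require Import structures.
From mathcomp Require Import all_boot all_order all_algebra.

Set Implicit Arguments.
Unset Strict Implicit.
Unset Printing Implicit Defensive.

Import Order.TTheory GRing.Theory Num.Theory.
Local Open Scope ring_scope.

Inductive step := U | D.

Definition step_to_bool (s : step) : bool := if s is U then true else false.
Definition bool_to_step (b : bool) : step := if b then U else D.

Lemma step_to_boolK : cancel step_to_bool bool_to_step.
Proof. by case. Qed.

HB.instance Definition _ := Finite.copy step (can_type step_to_boolK).

Definition height (w : seq step) (k : nat) : int :=
  (count_mem U (take k w))%:Z - (count_mem D (take k w))%:Z.

Definition dyck_path (n : nat) (P : seq step) : bool :=
  [&& size P == n.*2, count_mem U P == n, count_mem D P == n
    & [forall k : 'I_(size P).+1, 0 <= height P k]].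

Definition is_dyck (P : seq step) : Prop := exists n, dyck_path n P.

(* Positions are numbered from 0 here and below: the letter at index i is
   preceded by exactly i letters, so h_P(p - 1) for the 1-based position
   p = i + 1 is [height P i]. *)
Definition area (P : seq step) : seq int :=
  [seq height P i | i <- iota 0 (size P) & nth D P i == U].

Definition zeta_level (a : seq int) (r : nat) : seq step :=
  pmap (fun ai : int => if ai == r%:Z then Some U
                        else if ai == r%:Z - 1 then Some D
                        else None) a.

(* The entries of the area sequence of a Dyck path are nonnegative, so the
   value 0 used to start the maximum is harmless. *)
Definition area_max (a : seq int) : nat := absz (foldr Num.max 0 a).

Definition zeta (P : seq step) : seq step :=
  if P is [::] then [::]
  else flatten [seq zeta_level (area P) r | r <- iota 0 (area_max (area P)).+2].

(* [mso A k l]: MSO formulas over words on A whose free variables are the k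
   position variables 'I_k and the l set variables 'I_l (de Bruijn indices: a
   quantifier binds index 0 and shifts the other variables of its sort by 1).
   A formula phi(x_1, ..., x_k) has type [mso A k 0], with x_(i + 1) the
   variable i : 'I_k. *)
Inductive mso (A : Type) (k l : nat) : Type :=
  | MLt of 'I_k & 'I_k
  | MEq of 'I_k & 'I_k
  | MLetter of A & 'I_k
  | MIn of 'I_k & 'I_l
  | MNot of mso A k l
  | MAnd of mso A k l & mso A k l
  | MOr of mso A k l & mso A k l
  | MExPos of mso A k.+1 l
  | MAllPos of mso A k.+1 l
  | MExSet of mso A k l.+1
  | MAllSet of mso A k l.+1.

Definition pos (A : Type) (w : seq A) : finType := 'I_(size w).

Definition letter (A : Type) (w : seq A) (i : pos w) : A := tnth (in_tuple w) i.

Fixpoint sat (A : eqType) (w : seq A) (k l : nat) (phi : mso A k l) :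
    k.-tuple (pos w) -> l.-tuple {set pos w} -> bool :=
  match phi with
  | MLt x y => fun e _ => (tnth e x < tnth e y)%N
  | MEq x y => fun e _ => tnth e x == tnth e y
  | MLetter a x => fun e _ => letter (tnth e x) == a
  | MIn x X => fun e s => tnth e x \in tnth s X
  | MNot f => fun e s => ~~ sat f e s
  | MAnd f g => fun e s => sat f e s && sat g e s
  | MOr f g => fun e s => sat f e s || sat g e s
  | MExPos f => fun e s => [exists i : pos w, sat f [tuple of i :: e] s]
  | MAllPos f => fun e s => [forall i : pos w, sat f [tuple of i :: e] s]
  | MExSet f => fun e s => [exists I : {set pos w}, sat f e [tuple of I :: s]]
  | MAllSet f => fun e s => [forall I : {set pos w}, sat f e [tuple of I :: s]]
  end.

Definition holds (A : eqType) (w : seq A) (k : nat) (phi : mso A k 0)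
  (e : k.-tuple (pos w)) : bool := sat phi e [tuple].

Definition models (A : eqType) (w : seq A) (phi : mso A 0 0) : bool :=
  holds phi ([tuple] : 0.-tuple (pos w)).

(* Partial maps from words over A to words over B; [None] is "undefined". *)
Definition word_map (A B : Type) := seq A -> option (seq B).

(* The requirements relating the formulas of a polyregular presentation are
   stated in [presentation_axiom]. *)
Record presentation (A B : finType) := Presentation {
  copy : finType;
  arity : copy -> nat;
  dom_formula : mso A 0 0;
  sel_formula : forall c, mso A (arity c) 0;
  lab_formula : forall c, B -> mso A (arity c) 0;
  ord_formula : forall c c', mso A (arity c + arity c') 0
}.

Section Presentation.
Variables (A B : finType) (p : presentation A B).

Definition atom (w : seq A) : finType :=
  {c : copy p & (arity c).-tuple (pos w)}.

Definition selected (w : seq A) : {set atom w} :=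
  [set a : atom w | holds (sel_formula (tag a)) (tagged a)].

Definition has_label (w : seq A) (a : atom w) (b : B) : bool :=
  holds (lab_formula (tag a) b) (tagged a).

Definition chi (w : seq A) : rel (atom w) := fun a a' =>
  holds (ord_formula (tag a) (tag a')) [tuple of tagged a ++ tagged a'].

Definition strict_linear_on (T : finType) (S : {set T}) (lt : rel T) : Prop :=
  [/\ forall x, x \in S -> ~~ lt x x,
      forall x y z, x \in S -> y \in S -> z \in S ->
        lt x y -> lt y z -> lt x z
    & forall x y, x \in S -> y \in S -> x != y -> lt x y || lt y x].

Definition presentation_axiom : Prop :=
  [/\ (0 < #|copy p|)%N,
      forall c : copy p, (0 < arity c)%N,
      forall (w : seq A) (a : atom w),
        a \in selected w -> exists! b : B, has_label a b
    & forall w : seq A, strict_linear_on (selected w) (@chi w)].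

(* The labels of the selected atoms in increasing order for the strict order
   [lt]. [sort] takes a reflexive order, and [pmap] drops nothing as soon as
   every selected atom has a label. *)
Definition output (w : seq A) (lt : rel (atom w)) : seq B :=
  pmap (fun a : atom w => [pick b | has_label a b])
       (sort (fun a a' => (a == a') || lt a a') (enum (selected w))).

Definition polyregular_map : word_map A B := fun w =>
  if models w (dom_formula p) then Some (output (@chi w)) else None.

End Presentation.

Definition polyregular (A B : finType) (f : word_map A B) : Prop :=
  exists p : presentation A B,
    presentation_axiom p /\ forall w, f w = polyregular_map p w.

Record rank_source (A : finType) (d : nat) := RankSource {
  state : finType;
  init : state;
  trans : state -> A -> state;
  weight : state -> A -> 'rV[int]_d
}.

Section RankSource.
Variables (A : finType) (d : nat) (S : rank_source A d).

Definition state_before (w : seq A) (i : nat) : state S :=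
  foldl (@trans A d S) (init S) (take i w).

Definition prefix_rank (w : seq A) (i : nat) : 'rV[int]_d :=
  \sum_(j : pos w | (j < i)%N) weight (state_before w j) (letter j).

End RankSource.

Record rank_function (A : finType) (d k : nat) := RankFunction {
  rank_const : 'rV[int]_d;
  rank_src : 'I_k -> rank_source A d;
  rank_table : forall r, state (rank_src r) -> A -> 'rV[int]_d
}.

Definition rank_eval (A : finType) (d k : nat) (kappa : rank_function A d k)
    (w : seq A) (x : k.-tuple (pos w)) : 'rV[int]_d :=
  rank_const kappa +
  \sum_(r < k) (prefix_rank (rank_src kappa r) w (tnth x r) +
                rank_table (state_before (rank_src kappa r) w (tnth x r))
                           (letter (tnth x r))).

Definition lex_lt (d : nat) (u v : 'rV[int]_d) : bool :=
  [exists i : 'I_d,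
     [forall j : 'I_d, (j < i)%N ==> (u 0 j == v 0 j)] && (u 0 i < v 0 i)].

Record wrp_presentation (A B : finType) := WrpPresentation {
  wrp_base : presentation A B;
  wrp_dim : nat;
  wrp_rank : forall c : copy wrp_base, rank_function A wrp_dim (arity c)
}.

Section Wrp.
Variables (A B : finType) (q : wrp_presentation A B).

Definition atom_rank (w : seq A) (a : atom (wrp_base q) w)
  : 'rV[int]_(wrp_dim q) := rank_eval (wrp_rank (tag a)) (tagged a).

Definition wrp_prec (w : seq A) : rel (atom (wrp_base q) w) := fun a a' =>
  lex_lt (atom_rank a) (atom_rank a') ||
  (atom_rank a == atom_rank a') && chi a a'.

Definition wrp_map : word_map A B := fun w =>
  if models w (dom_formula (wrp_base q)) then Some (output (@wrp_prec w))
  else None.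

End Wrp.

Definition is_wrp (A B : finType) (f : word_map A B) : Prop :=
  exists q : wrp_presentation A B,
    presentation_axiom (wrp_base q) /\ forall w, f w = wrp_map q w.

(* Main.v *)
Require Import Defs.
From mathcomp Require Import all_boot all_order all_algebra.
From mathcomp Require Import zify.

(** Each up step of a Dyck path [P], starting at height [h], contributes to
    [zeta P] one letter [U] on level [h] and one letter [D] on level [h + 1];
    the letters are listed by level, and inside a level by position in [P].
    So [zeta] is computed by two copies of the set of up steps, one for each
    output letter, with rank the height, respectively the height plus one,
    and ties broken by position.  The height is a prefix sum, hence an
    additive rank: this is the weighted-rank presentation [zeta_wrp], and
    [zeta_wrp_output] checks it by exhibiting the list of atoms read off
    level by level and observing that it is strictly increasing, so that it
    is the sorted list ([sort_strict_linear_unique]).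

    Without ranks, a first-order property of the output is a monadic
    second-order property of the input, because quantifying over output
    positions is quantifying over atoms, that is over tuples of input
    positions.  By the theorem of Buechi, Elgot and Trakhtenbrot the words
    whose output has such a property form a regular language.  The property
    used here is that the last but one output letter is [D]
    ([regular_penultimate_label]).  Consider the words
    [two_peaks n m], that is [U^n D^n U^m D^m]: their area sequence is
    [0, ..., n - 1, 0, ..., m - 1].  If [n = m > 0], the last level holds one
    [D] for each peak, so the output ends in [DD]; if [n < m], the last level
    is a single [D] coming from the second peak and the level before it
    closes with the last [U] of that peak, so the output ends in [UD].
    A finite automaton cannot distinguish these cases: for suitable
    [t, k > 0] it does not see the difference between [t] and [t + k]
    consecutive equal letters ([regular_pump]), hence it treats
    [two_peaks t t] and [two_peaks t (t + k)] alike. *)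

Set Implicit Arguments.
Unset Strict Implicit.
Unset Printing Implicit Defensive.

Import Order.TTheory GRing.Theory Num.Theory.

(** * Enumerating a finite set along a strict linear order *)

Lemma sort_strict_linear (T : finType) (S : {set T}) (lt : rel T) :
  strict_linear_on S lt ->
  pairwise lt (sort (fun x y => (x == y) || lt x y) (enum S)).
Proof.
move=> [irr tr tot]; set le := fun x y => _.
have memS x : (x \in sort le (enum S)) = (x \in S) by rewrite mem_sort mem_enum.
have allS : all [in S] (sort le (enum S)) by apply/allP => x; rewrite memS.
have le_tot : {in S &, total le}.
  move=> x y Sx Sy; rewrite /le eq_sym; case: eqVneq => //= nxy.
  by apply: tot; rewrite 1?eq_sym.
have le_tr : {in S & &, transitive le}.
  move=> y x z Sy Sx Sz; rewrite /le.
  case/predU1P=> [->//|ltxy] /predU1P [<-|ltyz]; first by rewrite ltxy orbT.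
  by rewrite (tr x y z) ?orbT.
have enS : all [in S] (enum S) by apply/allP => x; rewrite mem_enum.
have := sort_sorted_in le_tot enS.
rewrite (sorted_pairwise_in le_tr allS) => pw.
have : uniq (sort le (enum S)) by rewrite sort_uniq enum_uniq.
rewrite uniq_pairwise => un.
have : pairwise [rel x y | le x y && (x != y)] (sort le (enum S)).
  by rewrite (pairwise_relI le (fun x y => x != y)) pw.
by apply: sub_pairwise => x y /= /andP[/predU1P[->|//]]; rewrite eqxx.
Qed.

(** To know the output of a presentation it is enough to guess the list of its
    atoms: a strictly increasing list of the right elements is the sorted
    one. *)
Lemma sort_strict_linear_unique (T : finType) (S : {set T}) (lt : rel T)
    (s : seq T) :
  strict_linear_on S lt -> pairwise lt s -> s =i S ->
  sort (fun x y => (x == y) || lt x y) (enum S) = s.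
Proof.
move=> lin pw memS; have [irr tr _] := lin.
have memL x : (x \in sort (fun x y => (x == y) || lt x y) (enum S)) = (x \in S).
  by rewrite mem_sort mem_enum.
apply: (irr_sorted_eq_in (leT := lt)).
- by move=> y x z; rewrite !memL => Sy Sx Sz; apply: tr.
- by move=> x; rewrite memL => Sx; apply/negbTE/irr.
- exact/pairwise_sorted/sort_strict_linear.
- exact: pairwise_sorted.
- by move=> x; rewrite memL memS.
Qed.

(** This makes `being the last but one element' a first-order property of the
    order.  The left-hand side asks for a pair [a < a'] such that no [b] above
    [a] is below or above [a']; this forces [a'] to be the last element and
    [a] the one just before. *)
Lemma penultimateE (T : finType) (S : {set T}) (lt : rel T) (P : pred T)
    (s : seq T) (x y : T) :
  strict_linear_on S lt -> pairwise lt (rcons (rcons s x) y) ->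
  rcons (rcons s x) y =i S ->
  [exists a, exists a', [&& a \in S, a' \in S, P a, lt a a' &
     ~~ [exists b, [&& b \in S, lt a b & lt b a' || lt a' b]]]] = P x.
Proof.
move=> [irr tr _]; rewrite !pairwise_rcons all_rcons.
case/andP=> /andP[ltxy /allP lty] /andP[/allP ltx _] memS.
have Sx : x \in S by rewrite -memS mem_rcons in_cons mem_rcons mem_head orbT.
have Sy : y \in S by rewrite -memS mem_rcons mem_head.
have asym a b : a \in S -> b \in S -> lt a b -> ~~ lt b a.
  move=> Sa Sb ab; apply/negP => ba; have := irr a Sa.
  by rewrite (tr a b a).
apply/existsP/idP => [[a /existsP[a' /and5P[Sa Sa' Pa ltaa' /existsPn nob]]]|Px].
  have ea' : a' = y.
    apply/eqP; apply: contraT => nya'.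
    have lta'y : lt a' y.
      move: Sa'; rewrite -memS mem_rcons in_cons mem_rcons in_cons (negbTE nya') /=.
      by case/predU1P=> [->//|/lty].
    by have := nob y; rewrite Sy (tr a a' y) //= lta'y orbT.
  move: ltaa' nob Sa' {lty}; rewrite {a'}ea' => ltay nob _.
  have nay : a != y by apply: contraTneq ltay => ->; apply: irr.
  move: (Sa); rewrite -memS mem_rcons in_cons mem_rcons in_cons (negbTE nay) /=.
  case/predU1P=> [<-//|/ltx ltax].
  by have := nob x; rewrite Sx ltax ltxy.
exists x; apply/existsP; exists y; rewrite Sx Sy Px ltxy /=.
apply/existsPn => b; apply/negP => /and3P[Sb ltxb].
have: b \in rcons (rcons s x) y by rewrite memS.
rewrite mem_rcons in_cons mem_rcons in_cons => /predU1P[->|/predU1P[ebx|sb]].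
- by rewrite orbb; apply/negP/irr.
- by move: ltxb; rewrite ebx (negbTE (irr _ Sx)).
- by have := asym _ _ Sx Sb ltxb; rewrite ltx.
Qed.

(** * Regular languages *)

(** Deterministic finite automata over an arbitrary, possibly infinite
    alphabet: in the proof for MSO the letters carry lists of truth values
    whose length varies with the number of free variables. *)
Definition regular (X : Type) (L : pred (seq X)) : Prop :=
  exists (Q : finType) (q0 : Q) (delta : Q -> X -> Q) (F : pred Q),
    forall u, L u = F (foldl delta q0 u).

Lemma regular_ext (X : Type) (L L' : pred (seq X)) :
  L =1 L' -> regular L -> regular L'.
Proof.
by move=> e [Q [q [d [F H]]]]; exists Q, q, d, F => u; rewrite -e H.
Qed.

Lemma regularN (X : Type) (L : pred (seq X)) :
  regular L -> regular (fun u => ~~ L u).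
Proof.
move=> [Q [q [d [F H]]]]; exists Q, q, d, (fun q => ~~ F q) => u.
by rewrite H.
Qed.

Lemma regularI (X : Type) (L L' : pred (seq X)) :
  regular L -> regular L' -> regular (fun u => L u && L' u).
Proof.
move=> [Q [q [d [F H]]]] [Q' [q' [d' [F' H']]]].
exists (Q * Q')%type, (q, q'),
  (fun r x => (d r.1 x, d' r.2 x)), (fun r => F r.1 && F' r.2) => u.
rewrite H H' -[q in LHS]/(q, q').1 -[q' in LHS]/(q, q').2.
by elim: u (q, q') => //= x u IHu r; rewrite -IHu.
Qed.

Lemma regular_preim (X Y : Type) (f : X -> Y) (L : pred (seq Y)) :
  regular L -> regular (fun u => L (map f u)).
Proof.
move=> [Q [q [d [F H]]]]; exists Q, q, (fun r x => d r (f x)), F => u.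
by rewrite H; congr F; elim: u q {H} => //= x u IHu r.
Qed.

Lemma regular_has (X : Type) (p : pred X) : regular (has p).
Proof.
exists bool, false, (fun b x => b || p x), id => u /=.
rewrite -[has p u]orFb; elim: u false => [|x u IHu] b /=; first exact: orbF.
by rewrite orbA IHu.
Qed.

(** The automaton waits for the first letter that satisfies [p] or [q] and
    then never changes its mind.  With [p] and [q] marking the values of two
    variables, this is the atomic formula [x < y]. *)
Lemma regular_find_lt (X : Type) (p q : pred X) :
  regular (fun u => find p u < find q u).
Proof.
exists (option bool), None,
  (fun o x => if o is Some b then Some b else
     if q x then Some false else if p x then Some true else None),
  (fun o => o == Some true).
have stay b u : foldl (fun o x => if o is Some b then Some b else
    if q x then Some false else if p x then Some true else None) (Some b) u
    = Some b by elim: u.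
by elim=> //= x u IHu; case: (q x) => //=; case: (p x); rewrite ?stay.
Qed.

Lemma regular_count1 (X : Type) (p : pred X) :
  regular (fun u => count p u == 1).
Proof.
(* The state counts the occurrences seen so far, up to 2. *)
exists 'I_3, ord0, (fun (r : 'I_3) x => inord (minn 2 (r + p x))),
  (fun r : 'I_3 => r == 1 :> nat).
move=> u; suff -> (r : 'I_3) :
    foldl (fun (r : 'I_3) x => inord (minn 2 (r + p x))) r u
      = minn 2 (r + count p u) :> nat.
  by case: (count p u) => [|[|[|n]]].
elim: u r => [|x u IHu] r /=.
  by rewrite addn0; apply/esym/minn_idPr; rewrite -ltnS.
rewrite IHu inordK; last by rewrite ltnS geq_minl.
by case: r => [[|[|[|]]]] //= _; case: (p x); rewrite /= ?add0n ?addn0 ?add1n ?add2n;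
   case: (count p u) => [|[|]].
Qed.

(** Forgetting a finite component of the letters is what interprets an
    existential quantifier. *)
Definition projection (X : Type) (K : finType) (L : pred (seq (X * K)))
  : pred (seq X) :=
  fun u => [exists t : (size u).-tuple K, L (zip u t)].

Lemma projectionP (X : Type) (K : finType) (L : pred (seq (X * K))) u :
  reflect (exists2 t : seq K, size t = size u & L (zip u t)) (projection L u).
Proof.
apply: (iffP existsP) => [[t Lt]|[t st Lt]].
  by exists t => //; rewrite size_tuple.
by move/eqP: st => st; exists (Tuple st).
Qed.

Lemma regular_projection (X : Type) (K : finType) (L : pred (seq (X * K))) :
  regular L -> regular (projection L).
Proof.
move=> [Q [q0 [d [F H]]]].
(* Powerset construction: the automaton guesses the forgotten component. *)
pose step (S : {set Q}) x := [set r | [exists q in S, exists k, d q (x, k) == r]].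
exists {set Q}, [set q0], step, (fun S : {set Q} => [exists q in S, F q]) => u.
have run (S : {set Q}) r : reflect (exists2 q, q \in S & exists2 t : seq K,
    size t = size u & foldl d q (zip u t) = r) (r \in foldl step S u).
  elim: u S => [|x u IHu] S /=.
    apply: (iffP idP) => [Sr|[q Sq [[]]] // _ <- //].
    by exists r => //; exists [::].
  apply: (iffP (IHu _)) => [[q]|[q Sq [[|k t] //= [st] e]]].
    rewrite inE => /exists_inP[q' Sq' /existsP[k /eqP e]] [t st <-].
    by exists q' => //; exists (k :: t); rewrite /= ?st ?e.
  exists (d q (x, k)); last by exists t.
  by rewrite inE; apply/exists_inP; exists q => //; apply/existsP; exists k.
apply/projectionP/exists_inP => [[t st]|[r /run[q]]].
  rewrite H => Fr; exists (foldl d q0 (zip u t)) => //; apply/run.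
  by exists q0; rewrite ?set11 //; exists t.
by rewrite inE => /eqP-> [t st e] Fr; exists t; rewrite ?H ?e.
Qed.

(** * Satisfaction of MSO formulas is recognised by finite automata *)

(** The word [w] with the values of the free variables written on its
    letters: the letter at [i] records which position variables have value
    [i], and which set variables contain [i]. *)
Definition mark (A : eqType) (w : seq A) (e : seq (pos w)) (s : seq {set pos w})
  : seq (A * seq bool * seq bool) :=
  [seq (letter i, [seq i == x | x <- e], [seq i \in Z | Z : {set pos w} <- s])
  | i <- enum (pos w)].

Definition relation (A : Type) (k l : nat) :=
  forall w : seq A, k.-tuple (pos w) -> l.-tuple {set pos w} -> bool.

(** Stated for relations rather than for formulas, so that substituting
    variables never requires rewriting a formula: it suffices to relabel the
    marks. *)
Definition recognizable (A : eqType) (k l : nat) (R : relation A k l) : Prop :=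
  exists2 L, regular L & forall w e s, R w e s = L (mark e s).

Section Closure.
Variables (A : eqType) (k l : nat).

Lemma recognizable_ext (R R' : relation A k l) :
  (forall w e s, R w e s = R' w e s) -> recognizable R -> recognizable R'.
Proof. by move=> e [L rL H]; exists L => // w x s; rewrite -e H. Qed.

Lemma recognizableN (R : relation A k l) :
  recognizable R -> recognizable (fun w e s => ~~ R w e s).
Proof.
move=> [L rL H]; exists (fun u => ~~ L u); first exact: regularN.
by move=> w e s; rewrite H.
Qed.

Lemma recognizableI (R R' : relation A k l) :
  recognizable R -> recognizable R' ->
  recognizable (fun w e s => R w e s && R' w e s).
Proof.
move=> [L rL H] [L' rL' H']; exists (fun u => L u && L' u).
  exact: regularI.
by move=> w e s; rewrite H H'.
Qed.

Lemma recognizableU (R R' : relation A k l) :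
  recognizable R -> recognizable R' ->
  recognizable (fun w e s => R w e s || R' w e s).
Proof.
move=> rR rR'.
apply: recognizable_ext (recognizableN
  (recognizableI (recognizableN rR) (recognizableN rR'))) => w e s.
by rewrite negb_and !negbK.
Qed.

Lemma recognizable_exists_fin (C : finType) (R : C -> relation A k l) :
  (forall c, recognizable (R c)) ->
  recognizable (fun w e s => [exists c, R c w e s]).
Proof.
move=> rR; apply: (@recognizable_ext (fun w e s => has (fun c => R c w e s) (enum C))).
  move=> w e s; apply/hasP/existsP => [[c _ Rc]|[c Rc]]; exists c => //.
  by rewrite mem_enum.
elim: (enum C) => [|c r IHr] /=; last exact: recognizableU.
exists (has pred0); first exact: regular_has.
by move=> w e s; rewrite has_pred0.
Qed.

(** Guessing one bit at each letter of a marked word amounts to choosing a set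
    of positions. *)
Lemma marks_projectionP (w : seq A) (e : seq (pos w)) (s : seq {set pos w})
    (L : pred (seq (A * seq bool * seq bool * bool))) :
  reflect (exists I : {set pos w},
             L (zip (mark e s) [seq j \in I | j <- enum (pos w)]))
          (projection L (mark e s)).
Proof.
apply: (iffP (projectionP _ _)) => [[t]|[I LI]].
  rewrite size_map -cardE card_ord => st Lt.
  exists [set j : pos w | nth false t j].
  suff -> : [seq j \in [set j : pos w | nth false t j] | j <- enum (pos w)] = t.
    by [].
  apply: (@eq_from_nth _ false); first by rewrite size_map -cardE card_ord st.
  move=> i; rewrite size_map size_enum_ord => lti.
  rewrite (nth_map (Ordinal lti)) ?size_enum_ord // inE.
  by rewrite nth_enum_ord.
by exists [seq j \in I | j <- enum (pos w)]; rewrite ?size_map.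
Qed.

Lemma recognizable_exists_set (R : relation A k l.+1) :
  recognizable R ->
  recognizable (fun w e s => [exists I : {set pos w}, R w e [tuple of I :: s]]).
Proof.
move=> [L rL H].
pose g (m : A * seq bool * seq bool * bool) := (m.1.1, m.2 :: m.1.2).
exists (projection (fun u => L (map g u))).
  exact/regular_projection/regular_preim.
move=> w e s.
have gE (I : {set pos w}) : map g (zip (mark e s) [seq j \in I | j <- enum (pos w)])
              = mark e (I :: s) by rewrite /mark zip_map -map_comp.
apply/existsP/marks_projectionP => -[I HI]; exists I.
  by rewrite gE -[I :: s]/(tval [tuple of I :: s]) -H.
by rewrite H -gE.
Qed.

(** A position is a set with one element, so the guessed bits are required to
    contain a single 1. *)
Lemma recognizable_exists_pos (R : relation A k.+1 l) :
  recognizable R ->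
  recognizable (fun w e s => [exists i : pos w, R w [tuple of i :: e] s]).
Proof.
move=> [L rL H].
pose g (m : A * seq bool * seq bool * bool) := (m.1.1.1, m.2 :: m.1.1.2, m.1.2).
exists (projection (fun u => L (map g u) && (count snd u == 1))).
  apply/regular_projection/regularI; first exact: regular_preim.
  exact: regular_count1.
move=> w e s.
have gE (i : pos w) : map g (zip (mark e s) [seq j \in [set i] | j <- enum (pos w)])
              = mark (i :: e) s.
  rewrite /mark zip_map -map_comp; apply: eq_map => j /=.
  by rewrite /g /= inE.
have cE (I : {set pos w}) : count snd (zip (mark e s) [seq j \in I | j <- enum (pos w)]) = #|I|.
  by rewrite /mark zip_map count_map -size_filter cardE /enum_mem
    -filter_predI; congr size; apply: eq_filter => j; rewrite /= andbT.
apply/existsP/marks_projectionP => [[i HI]|[I /andP[]]].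
  by exists [set i]; rewrite gE cE cards1 andbT -[i :: e]/(tval [tuple of i :: e]) -H.
by rewrite cE => HI /cards1P[i eI]; exists i; rewrite H /= -gE -eI.
Qed.

End Closure.

Lemma nth_marks (T : eqType) k (e : k.-tuple T) (y : T) (x : 'I_k) :
  nth false [seq y == z | z <- e] x = (tnth e x == y).
Proof. by rewrite (nth_map y) ?size_tuple // -tnth_nth eq_sym. Qed.

Lemma has_mark (A : eqType) (w : seq A) (e : seq (pos w)) s (i : pos w)
    (p q : pred (A * seq bool * seq bool)) :
  (forall j, p (letter j, [seq j == z | z <- e], [seq j \in Z | Z : {set pos w} <- s])
     = (i == j) && q (letter j, [seq j == z | z <- e], [seq j \in Z | Z : {set pos w} <- s])) ->
  has p (mark e s) = q (letter i, [seq i == z | z <- e], [seq i \in Z | Z : {set pos w} <- s]).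
Proof.
move=> pE; rewrite has_map; apply/hasP/idP => [[j _ /=]|qi].
  by rewrite pE => /andP[/eqP<-].
by exists i; rewrite ?mem_enum //= pE eqxx.
Qed.

Lemma find_mark (A : eqType) (w : seq A) k (e : k.-tuple (pos w)) s (x : 'I_k) :
  find (fun m => nth false m.1.2 x) (@mark A w e s) = tnth e x.
Proof.
rewrite find_map -[RHS]index_enum_ord /index; apply: eq_find => j /=.
by rewrite nth_marks eq_sym.
Qed.

(** One half of the theorem of Buechi, Elgot and Trakhtenbrot: formulas are
    translated into automata by induction. *)
Lemma sat_recognizable (A : eqType) (k l : nat) (phi : mso A k l) :
  recognizable (fun w e s => sat phi e s).
Proof.
elim: phi => {k l} [k l x y|k l x y|k l a x|k l x X|k l f IHf|k l f IHf g IHg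
  |k l f IHf g IHg|k l f IHf|k l f IHf|k l f IHf|k l f IHf] /=.
- pose p z (m : A * seq bool * seq bool) := nth false m.1.2 z.
  exists (fun u => find (p x) u < find (p y) u); first exact: regular_find_lt.
  by move=> w e s; rewrite !find_mark.
- exists (has (fun m => nth false m.1.2 x && nth false m.1.2 y)).
    exact: regular_has.
  move=> w e s; rewrite (@has_mark _ _ _ _ (tnth e x) _
    (fun m => nth false m.1.2 y)) /=; first by rewrite nth_marks eq_sym.
  by move=> j; rewrite !nth_marks.
- exists (has (fun m => nth false m.1.2 x && (m.1.1 == a))).
    exact: regular_has.
  move=> w e s; rewrite (@has_mark _ _ _ _ (tnth e x) _ (fun m => m.1.1 == a)) //.
  by move=> j; rewrite !nth_marks.
- exists (has (fun m => nth false m.1.2 x && nth false m.2 X)).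
    exact: regular_has.
  move=> w e s; rewrite (@has_mark _ _ _ _ (tnth e x) _ (fun m => nth false m.2 X)) /=.
    by rewrite (nth_map set0) ?size_tuple // -tnth_nth.
  by move=> j; rewrite !nth_marks.
- exact: recognizableN.
- exact: recognizableI.
- exact: recognizableU.
- exact: (recognizable_exists_pos IHf).
- have := recognizableN (recognizable_exists_pos (recognizableN IHf)).
  apply: recognizable_ext => w e s; rewrite negb_exists.
  by apply: eq_forallb => i; rewrite negbK.
- exact: (recognizable_exists_set IHf).
- have := recognizableN (recognizable_exists_set (recognizableN IHf)).
  apply: recognizable_ext => w e s; rewrite negb_exists.
  by apply: eq_forallb => i; rewrite negbK.
Qed.

(** * First-order properties of the output of a polyregular map *)

(** Renaming variables only permutes, copies or drops marks. *)
Lemma recognizable_rename (A : eqType) (k m l : nat) (R : relation A k l)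
    (h : 'I_k -> 'I_m) :
  recognizable R ->
  recognizable (fun w (e : m.-tuple (pos w)) s =>
                  R w [tuple tnth e (h i) | i < k] s).
Proof.
move=> [L rL H].
pose g (x : A * seq bool * seq bool) :=
  (x.1.1, [seq nth false x.1.2 (h i) | i <- enum 'I_k], x.2).
exists (fun u => L (map g u)); first exact: regular_preim.
move=> w e s; rewrite H; congr L; rewrite /mark -map_comp.
apply: eq_map => j /=; rewrite /g /=; congr (_, _, _).
rewrite -map_comp; apply: eq_map => i /=.
by rewrite nth_marks eq_sym.
Qed.

Lemma recognizable_exists_tuple (A : eqType) (k m l : nat)
    (R : relation A (k + m) l) :
  recognizable R ->
  recognizable (fun w (e : m.-tuple (pos w)) s =>
    [exists x : k.-tuple (pos w), R w [tuple of x ++ e] s]).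
Proof.
elim: k R => [|k IHk] R rR.
  apply: recognizable_ext rR => w e s; apply/idP/existsP => [Re|[x]].
    by exists [tuple]; congr (R w _ s): Re; apply: val_inj.
  by congr (R w _ s); apply: val_inj; rewrite tuple0.
apply: recognizable_ext (IHk _ (recognizable_exists_pos rR)) => w e s.
apply/existsP/existsP => [[x /existsP[i Rx]]|[x Rx]].
  exists [tuple of i :: x]; congr (R w _ s): Rx; exact: val_inj.
exists [tuple of behead x]; apply/existsP; exists (thead x).
by congr (R w _ s): Rx; apply: val_inj; rewrite /= {1}(tuple_eta x).
Qed.

Section Atoms.
Variables (A B : finType) (p : presentation A B).

(** An atom is a copy name with a tuple of positions, so quantifying over
    atoms is a finite disjunction of blocks of position quantifiers.  The
    positions of the new atom are put in front of the environment [e]. *)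
Lemma recognizable_exists_atom (m l : nat)
    (R : forall c : copy p, relation A (arity c + m) l) :
  (forall c, recognizable (R c)) ->
  recognizable (fun w (e : m.-tuple (pos w)) s =>
    [exists a : atom p w, R (tag a) w [tuple of tagged a ++ e] s]).
Proof.
move=> rR.
have := recognizable_exists_fin (fun c => recognizable_exists_tuple (rR c)).
apply: recognizable_ext => w e s; apply/existsP/existsP.
  by move=> [c /existsP[x Rx]]; exists (Tagged (fun c => (arity c).-tuple (pos w)) x).
by move=> [[c x] Rx]; exists c; apply/existsP; exists x.
Qed.

(** Formulas of the presentation applied to positions found in the
    environment: [h] tells where. *)
Lemma recognizable_holds (k m l : nat) (phi : mso A k 0) (h : 'I_k -> 'I_m) :
  recognizable (fun w (e : m.-tuple (pos w)) (s : l.-tuple {set pos w}) =>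
                  holds phi [tuple tnth e (h i) | i < k]).
Proof.
have [L rL H] := recognizable_rename h (sat_recognizable phi).
pose g (x : A * seq bool * seq bool) := (x.1, [::] : seq bool).
exists (fun u => L (map g u)); first exact: regular_preim.
move=> w e s; rewrite /holds H; congr L.
by rewrite /mark -[in RHS]map_comp; apply: eq_map.
Qed.

Lemma recognizable_chi (c c' : copy p) (m l : nat)
    (f : 'I_(arity c) -> 'I_m) (g : 'I_(arity c') -> 'I_m) :
  recognizable (fun w (e : m.-tuple (pos w)) (s : l.-tuple {set pos w}) =>
    holds (ord_formula c c') [tuple of [tuple tnth e (f i) | i < arity c] ++
                                      [tuple tnth e (g i) | i < arity c']]).
Proof.
have := @recognizable_holds _ m l (ord_formula c c')
  (fun i => match split i with inl i => f i | inr i => g i end).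
apply: recognizable_ext => w e s; congr holds.
apply: eq_from_tnth => i; rewrite tnth_mktuple.
by case: split_ordP => j ->; rewrite ?tnth_lshift ?tnth_rshift tnth_mktuple.
Qed.

(** The first-order formula of [penultimateE], for the order [chi] and the
    property of carrying the label [b]. *)
Definition penultimate_label (b : B) (w : seq A) : bool :=
  [exists a : atom p w, exists a' : atom p w,
    [&& a \in selected p w, a' \in selected p w, has_label a b, chi a a' &
     ~~ [exists a'' : atom p w,
          [&& a'' \in selected p w, chi a a'' & chi a'' a' || chi a' a'']]]].

Lemma regular_penultimate_label (b : B) : regular (penultimate_label b).
Proof.
suff [L rL H] : recognizable (fun w (_ : 0.-tuple (pos w)) (_ : 0.-tuple {set pos w}) =>
    penultimate_label b w).
  have := regular_preim (fun a : A => (a, [::] : seq bool, [::] : seq bool)) rL.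
  apply: regular_ext => w; rewrite (H w [tuple] [tuple]); congr L.
  have ew : w = [seq letter i | i <- enum (pos w)].
    exact/esym/(map_tnth_enum (in_tuple w)).
  by rewrite /mark {1}ew -[LHS]map_comp; apply: eq_map.
(* Where to find the innermost atom, the one before, and the one before that
   in the environment built by nested quantifiers over atoms. *)
pose va m k (i : 'I_k) : 'I_(k + m) := lshift m i.
pose vb (m k k' : nat) (i : 'I_k) : 'I_(k' + (k + m)) := rshift k' (va m k i).
pose vc (m k k' k'' : nat) (i : 'I_k) : 'I_(k'' + (k' + (k + m))) :=
  rshift k'' (vb m k k' i).
have vaE T m k (x : k.-tuple T) (e : m.-tuple T) :
  [tuple tnth [tuple of x ++ e] (va m k i) | i < k] = x.
  by apply: eq_from_tnth => i; rewrite tnth_mktuple tnth_lshift.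
have vbE T m k k' (x : k.-tuple T) (y : k'.-tuple T) (e : m.-tuple T) :
  [tuple tnth [tuple of y ++ [tuple of x ++ e]] (vb m k k' i) | i < k] = x.
  by apply: eq_from_tnth => i; rewrite tnth_mktuple tnth_rshift tnth_lshift.
have vcE T m k k' k'' (x : k.-tuple T) (y : k'.-tuple T) (z : k''.-tuple T)
    (e : m.-tuple T) :
  [tuple tnth [tuple of z ++ [tuple of y ++ [tuple of x ++ e]]] (vc m k k' k'' i)
    | i < k] = x.
  by apply: eq_from_tnth => i; rewrite tnth_mktuple !tnth_rshift tnth_lshift.
have := recognizable_exists_atom (fun c => recognizable_exists_atom (fun c' =>
  recognizableI (recognizable_holds 0 (sel_formula c) (@vb 0 _ _))
  (recognizableI (recognizable_holds 0 (sel_formula c') (@va _ _))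
  (recognizableI (recognizable_holds 0 (lab_formula c b) (@vb 0 _ _))
  (recognizableI (recognizable_chi 0 (@vb 0 _ _) (@va _ _))
  (recognizableN (recognizable_exists_atom (fun c'' =>
    recognizableI (recognizable_holds 0 (sel_formula c'') (@va _ _))
    (recognizableI (recognizable_chi 0 (@vc 0 _ _ _) (@va _ _))
    (recognizableU (recognizable_chi 0 (@va _ _) (@vb _ _ _))
                   (recognizable_chi 0 (@vb _ _ _) (@va _ _)))))))))))).
apply: recognizable_ext => w e s.
apply: eq_existsb => a; apply: eq_existsb => a'.
rewrite !inE !vaE !vbE; congr [&& _, _, _, _ & ~~ _].
by apply: eq_existsb => a''; rewrite !vaE !vbE !vcE !inE.
Qed.

End Atoms.

(** Relates the first-order description to the word computed by [output]: all
    selected atoms are labelled, so the letters of the output correspond one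
    to one to the entries of the sorted list of atoms. *)
Lemma penultimate_labelE (A B : finType) (p : presentation A B) (w : seq A)
    (u : seq B) (b b' c : B) :
  presentation_axiom p -> output (@chi A B p w) = u ++ [:: b; c] ->
  penultimate_label p b' w = (b' == b).
Proof.
move=> [_ _ lab /(_ w) lin]; rewrite /output.
move: (sort_strict_linear lin).
set s := sort _ _ => pw.
have memS : s =i selected p w by move=> a; rewrite mem_sort mem_enum.
have labE a : a \in s -> exists b0,
    [pick b1 | has_label a b1] = Some b0 /\ forall b1, has_label a b1 = (b1 == b0).
  rewrite memS => /lab[b0 [Hb0 uniq_b0]].
  have E b1 : has_label a b1 = (b1 == b0).
    by apply/idP/eqP => [/uniq_b0|->].
  exists b0; split=> //; case: pickP => [b1|/(_ b0)]; last by rewrite E eqxx.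
  by rewrite E => /eqP->.
move: pw memS labE; case/lastP: s => [|s y]; first by case: u.
case/lastP: s => [|s x] pw memS labE out.
  have [|b0 [e _]] := labE y; first by rewrite mem_rcons mem_head.
  by move/(congr1 size): out; rewrite /= e size_cat addn2.
rewrite /penultimate_label (penultimateE (fun a => has_label a b') lin pw memS).
have [|b0 [ex E]] := labE x; first by rewrite mem_rcons in_cons mem_rcons mem_head orbT.
have [|b1 [ey _]] := labE y; first by rewrite mem_rcons mem_head.
move: out; rewrite -!cats1 !pmap_cat /= ex ey -catA /= => out.
have := congr1 rev out; rewrite !rev_cat /= => -[_ <- _].
by rewrite E.
Qed.

(** * Pumping *)

Lemma foldl_nseq (Q X : Type) (d : Q -> X -> Q) q n x :
  foldl d q (nseq n x) = iter n (fun q => d q x) q.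
Proof. by elim: n q => //= n IHn q; rewrite IHn -iterSr. Qed.

(** Reading [n] copies of a letter acts on the states as the [n]-th power of a
    map of a finite set to itself; by the pigeonhole principle two powers
    agree, simultaneously for all letters of a finite alphabet. *)
Lemma regular_pump (X : finType) (L : pred (seq X)) :
  regular L -> exists t p, [/\ 0 < t, 0 < p &
    forall x u v, L (u ++ nseq (t + p) x ++ v) = L (u ++ nseq t x ++ v)].
Proof.
move=> [Q [q0 [d [F H]]]].
pose T := {ffun X -> {ffun Q -> Q}}.
pose f (n : 'I_#|T|.+1) : T :=
  [ffun x => [ffun q => iter n.+1 (fun q => d q x) q]].
have [i [j ltij fij]] : exists i : 'I_#|T|.+1, exists2 j : 'I_#|T|.+1, i < j & f i = f j.
  have /injectivePn[i [j nij fij]] : ~~ injectiveb f.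
    apply/injectiveP => inj_f; have := leq_card f inj_f.
    by rewrite card_ord ltnn.
  case: (ltngtP i j) => [ltij|ltji|/val_inj eij].
  - by exists i, j.
  - by exists j, i.
  - by rewrite eij eqxx in nij.
exists i.+1, (j - i); split=> [//||x u v]; first by rewrite subn_gt0.
rewrite addSn subnKC; last exact: ltnW.
rewrite !H !foldl_cat !foldl_nseq; congr (F (foldl _ _ _)).
have := congr1 (fun g : T => g x (foldl d q0 u)) fij.
by rewrite !ffunE.
Qed.

(** * Height, area and zeta of concatenated words *)

Section Heights.
Local Open Scope ring_scope.

Lemma height_cat_l (P Q : seq step) k :
  (k <= size P)%N -> height (P ++ Q) k = height P k.
Proof. by move=> lek; rewrite /height takel_cat. Qed.

Lemma height_cat_r (P Q : seq step) k :
  height (P ++ Q) (size P + k) = height P (size P) + height Q k.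
Proof.
rewrite /height take_size take_cat ltnNge leq_addr /= addKn !count_cat; lia.
Qed.

Lemma height_nseq (x : step) n k : (k <= n)%N ->
  height (nseq n x) k = if x is U then k%:Z else - k%:Z.
Proof.
move=> lekn; rewrite /height take_nseq // !count_nseq.
by case: x => /=; rewrite ?mul1n ?mul0n ?subr0 ?sub0r.
Qed.

Lemma area_cat (P Q : seq step) :
  area (P ++ Q) = area P ++ [seq height P (size P) + h | h <- area Q].
Proof.
rewrite /area size_cat iotaD filter_cat map_cat; congr (_ ++ _).
  rewrite (@eq_in_filter _ _ (fun i => nth D P i == U)).
    apply/eq_in_map => i; rewrite mem_filter mem_iota => /andP[_ lti].
    by rewrite height_cat_l // ltnW.
  by move=> i; rewrite mem_iota /= => lti; rewrite nth_cat lti.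
rewrite add0n -[X in iota X _]addn0 iotaDl filter_map -!map_comp.
rewrite (@eq_filter _ _ (fun i => nth D Q i == U)).
  by apply: eq_map => i /=; rewrite height_cat_r.
by move=> i /=; rewrite nth_cat ltnNge leq_addr /= addKn.
Qed.

Lemma area_nseqU n : area (nseq n U) = [seq i%:Z | i <- iota 0 n].
Proof.
rewrite /area size_nseq (@eq_in_filter _ _ predT) ?filter_predT.
  by apply/eq_in_map => i; rewrite mem_iota => lti; rewrite height_nseq // ltnW.
by move=> i; rewrite mem_iota nth_nseq /= => ->.
Qed.

Lemma area_nseqD n : area (nseq n D) = [::].
Proof.
rewrite /area size_nseq (@eq_in_filter _ _ pred0) ?filter_pred0 //.
by move=> i; rewrite mem_iota nth_nseq if_same.
Qed.

Lemma dyck_path_cat n m (P Q : seq step) :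
  dyck_path n P -> dyck_path m Q -> dyck_path (n + m) (P ++ Q).
Proof.
case/and4P=> /eqP sP /eqP uP /eqP dP /forallP hP.
case/and4P=> /eqP sQ /eqP uQ /eqP dQ /forallP hQ.
apply/and4P; split; rewrite ?size_cat ?count_cat ?sP ?sQ ?uP ?uQ ?dP ?dQ ?doubleD //.
apply/forallP => k; case: (leqP k (size P)) => lek.
  by rewrite height_cat_l //; exact: (hP (Ordinal (lek : (k < (size P).+1)%N))).
have lek' : (k - size P < (size Q).+1)%N.
  by rewrite ltnS leq_subLR sP sQ -ltnS.
rewrite -(subnKC (ltnW lek)) height_cat_r addr_ge0 //.
  exact: (hP ord_max).
exact: (hQ (Ordinal lek')).
Qed.

Lemma dyck_path_peak n : dyck_path n (nseq n U ++ nseq n D).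
Proof.
apply/and4P; split; rewrite ?size_cat ?count_cat ?size_nseq ?count_nseq /=
  ?mul1n ?mul0n ?addn0 ?addnn //.
apply/forallP => -[k /=]; rewrite ltnS => lek.
case: (leqP k n) => [lekn|/ltnW lenk].
  by rewrite height_cat_l ?size_nseq // height_nseq.
have -> : k = (size (nseq n U) + (k - n))%N by rewrite size_nseq subnKC.
rewrite height_cat_r size_nseq !height_nseq //; lia.
Qed.

Definition two_peaks (n m : nat) : seq step :=
  (nseq n U ++ nseq n D) ++ (nseq m U ++ nseq m D).

Lemma is_dyck_two_peaks n m : is_dyck (two_peaks n m).
Proof. by exists (n + m)%N; apply: dyck_path_cat; apply: dyck_path_peak. Qed.

Lemma area_peak n : area (nseq n U ++ nseq n D) = [seq i%:Z | i <- iota 0 n].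
Proof. by rewrite area_cat area_nseqU area_nseqD cats0. Qed.

Lemma area_two_peaks n m :
  area (two_peaks n m) = [seq i%:Z | i <- iota 0 n ++ iota 0 m].
Proof.
rewrite area_cat !area_peak map_cat; congr (_ ++ _).
rewrite -[RHS]map_id; apply: eq_map => h.
rewrite size_cat height_cat_r !size_nseq !height_nseq //; lia.
Qed.

Lemma area_max_nat (s : seq nat) : area_max [seq i%:Z | i <- s] = foldr maxn 0%N s.
Proof.
rewrite /area_max; suff -> : foldr Num.max 0 [seq i%:Z | i <- s] = (foldr maxn 0%N s)%:Z.
  by [].
by elim: s => //= i s ->; lia.
Qed.

Lemma foldr_maxn_iota n j : foldr maxn j (iota 0 n) = maxn n.-1 j.
Proof.
elim: n j => [|n IHn] j; first by rewrite max0n.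
by rewrite -addn1 iotaD foldr_cat IHn /=; lia.
Qed.

(** On the empty path the general formula scans two empty levels, in agreement
    with the convention. *)
Lemma zetaE (P : seq step) :
  zeta P = flatten [seq zeta_level (area P) r | r <- iota 0 (area_max (area P)).+2].
Proof. by case: P. Qed.

Lemma zeta_level_cat (a b : seq int) r :
  zeta_level (a ++ b) r = zeta_level a r ++ zeta_level b r.
Proof. exact: pmap_cat. Qed.

(** A single peak climbs through the levels one by one: level [r] receives a
    [D] from the step ending there, then a [U] from the step starting
    there. *)
Lemma zeta_level_iota n r :
  zeta_level [seq i%:Z | i <- iota 0 n] r = nseq (0 < r <= n)%N D ++ nseq (r < n)%N U.
Proof.
elim: n => [|n IHn]; first by case: r.
rewrite -addn1 iotaD map_cat zeta_level_cat IHn /zeta_level /= addn1 add0n.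
case: (ltngtP r n) => [ltrn|ltnr|->].
- have -> : (n%:Z == r%:Z) = false by lia.
  have -> : (n%:Z == r%:Z - 1) = false by lia.
  by rewrite cats0 leqW ?(ltnW ltrn) // ltnS (ltnW ltrn).
- have -> : (n%:Z == r%:Z) = false by lia.
  have -> : (n%:Z == r%:Z - 1) = (r <= n.+1)%N by lia.
  have -> : (r < n.+1)%N = false by lia.
  by rewrite andbF (leq_trans _ ltnr) //=; case: (r <= _)%N.
- by rewrite eqxx ltnSn leqnSn cats0 andbT.
Qed.

(** The last level [n] receives one [D] from each of the two peaks. *)
Lemma zeta_two_peaks_eq n :
  (0 < n)%N -> exists u, zeta (two_peaks n n) = u ++ [:: D; D].
Proof.
move=> n0; rewrite zetaE area_two_peaks area_max_nat.
rewrite foldr_cat !foldr_maxn_iota maxn0 maxnn (ltn_predK n0).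
rewrite -[n.+1]addn1 iotaD map_cat flatten_cat.
eexists; congr (_ ++ _) => /=.
by rewrite map_cat zeta_level_cat !zeta_level_iota ltnn leqnn n0.
Qed.

(** Here the last two levels matter: level [m - 1] ends with the last [U] of
    the second, higher peak, and level [m] is reduced to one [D]. *)
Lemma zeta_two_peaks_lt n m :
  (n < m)%N -> exists u, zeta (two_peaks n m) = u ++ [:: U; D].
Proof.
move=> ltnm; rewrite zetaE area_two_peaks area_max_nat.
have m0 : (0 < m)%N by apply: leq_ltn_trans ltnm.
rewrite foldr_cat !foldr_maxn_iota maxn0.
have -> : (maxn n.-1 m.-1).+2 = (m.-1 + 2)%N by lia.
rewrite iotaD map_cat flatten_cat /= add0n prednK // cats0.
rewrite !map_cat !zeta_level_cat !zeta_level_iota ltnn leqnn m0 ltn_predL m0.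
have -> : (m <= n)%N = false by lia.
have -> : (m < n)%N = false by lia.
by rewrite andbF /= !catA -catA; eexists; reflexivity.
Qed.

End Heights.

(** * Impossibility for polyregular maps *)

Lemma zeta_not_polyregular (T : word_map step step) :
  polyregular T -> ~ (forall P, is_dyck P -> T P = Some (zeta P)).
Proof.
move=> [p [ax TE]] H.
have [t [k [t0 k0 pump]]] := regular_pump (regular_penultimate_label p D).
have pen n m u b c : zeta (two_peaks n m) = u ++ [:: b; c] ->
    penultimate_label p D (two_peaks n m) = (D == b).
  move=> e; apply: penultimate_labelE ax _.
  have := H _ (is_dyck_two_peaks n m); rewrite TE /polyregular_map.
  by case: ifP => // _ [->]; exact: e.
have [u /pen penD] := zeta_two_peaks_eq t0.
have [v /pen penU] : exists u, zeta (two_peaks t (t + k)) = u ++ [:: U; D].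
  by apply: zeta_two_peaks_lt; rewrite -[X in X < _]addn0 ltn_add2l.
suff : penultimate_label p D (two_peaks t t)
     = penultimate_label p D (two_peaks t (t + k)) by rewrite penD penU.
have -> : two_peaks t (t + k) = ((nseq t U ++ nseq t D) ++ nseq (t + k) U)
    ++ nseq (t + k) D ++ [::] by rewrite /two_peaks cats0 !catA.
by rewrite pump cats0 -[X in _ = _ X]catA pump.
Qed.

(** * A weighted-rank presentation of zeta *)

Section ZetaWrp.
Local Open Scope ring_scope.

(** Formulas for the two truth values; they need a variable to speak of. *)
Definition formula_of_bool (k : nat) (b : bool) : mso step k.+1 0 :=
  if b then MEq step 0 ord0 ord0 else MNot (MEq step 0 ord0 ord0).

Lemma holds_formula_of_bool k b (w : seq step) (e : k.+1.-tuple (pos w)) :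
  holds (formula_of_bool k b) e = b.
Proof. by case: b; rewrite /holds /= eqxx. Qed.

Definition copy_label (c : bool) : step := if c then U else D.

(** Copy [true] of an up step produces its letter [U], copy [false] its letter
    [D].  Atoms are compared by position; the order
    of the two copies of one step is an arbitrary choice that makes [chi]
    linear. *)
Definition zeta_base : presentation step step :=
  @Presentation step step bool (fun=> 1%N)
    (MAllPos (formula_of_bool 0 true))
    (fun=> MLetter 0 U ord0)
    (fun c b => formula_of_bool 0 (b == copy_label c))
    (fun c c' => MOr (MLt step 0 (ord0 : 'I_(1 + 1)) ord_max)
       (MAnd (MEq step 0 (ord0 : 'I_(1 + 1)) ord_max)
             (formula_of_bool 1 (c && ~~ c')))).

Definition height_source : rank_source step 1 :=
  @RankSource step 1 unit tt (fun _ _ => tt)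
    (fun _ x => const_mx (if x is U then 1 else -1)).

(** The constant [~~ c] lifts the letters [D] by one level. *)
Definition zeta_wrp : wrp_presentation step step :=
  @WrpPresentation step step zeta_base 1
    (fun c : bool => @RankFunction step 1 1 (const_mx (~~ c)%:Z)
       (fun=> height_source) (fun _ _ _ => 0)).

Section Word.
Variable w : seq step.

Local Notation zatom := (atom zeta_base w).

Definition atom_copy (a : zatom) : bool := tag a.
Definition atom_pos (a : zatom) : pos w := tnth (tagged a : 1.-tuple _) ord0.
Definition Atom (i : pos w) (c : bool) : zatom :=
  @Tagged bool c (fun=> 1.-tuple (pos w)) [tuple i].
(** The level of the zeta map on which the label of the atom is written; by
    [atom_rankE] it is the rank. *)
Definition atom_level (a : zatom) : int :=
  height w (atom_pos a) + (~~ atom_copy a)%:Z.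

Lemma AtomK a : Atom (atom_pos a) (atom_copy a) = a.
Proof.
case: a => c x; rewrite /Atom /atom_pos /atom_copy /=; congr existT.
apply: eq_from_tnth => i; rewrite (ord1 i).
by rewrite [LHS](tnth_nth (tnth x ord0)).
Qed.

Lemma selectedE a : (a \in selected zeta_base w) = (letter (atom_pos a) == U).
Proof. by rewrite inE. Qed.

Lemma has_labelE (a : zatom) b : has_label a b = (b == copy_label (atom_copy a)).
Proof. exact: holds_formula_of_bool. Qed.

Lemma chiE (a a' : zatom) : chi a a' =
  (atom_pos a < atom_pos a')%N ||
  (atom_pos a == atom_pos a') && (atom_copy a && ~~ atom_copy a').
Proof.
pose e : (1 + 1).-tuple (pos w) :=
  [tuple of (tagged a : 1.-tuple _) ++ (tagged a' : 1.-tuple _)].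
have e0 : tnth e ord0 = atom_pos a.
  by rewrite /atom_pos -(tnth_lshift _ (tagged a')); congr tnth; apply: val_inj.
have e1 : tnth e ord_max = atom_pos a'.
  by rewrite /atom_pos -(tnth_rshift (tagged a)); congr tnth; apply: val_inj.
rewrite -[RHS]/(_ || _ && _) -e0 -e1.
by rewrite -(holds_formula_of_bool (atom_copy a && ~~ atom_copy a') e).
Qed.

Lemma height_sum i : (i <= size w)%N ->
  height w i = \sum_(j < size w | (j < i)%N) (if letter j is U then 1 else -1).
Proof.
move=> lei; pose f (j : nat) : int := if nth D w j is U then 1 else -1.
rewrite (eq_bigr (fun j : 'I_(size w) => f j)); last first.
  by move=> j _; rewrite /f /letter (tnth_nth D).
rewrite -(big_ord_widen _ f lei).
elim: i lei => [|i IHi] lti; first by rewrite big_ord0 /height take0.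
rewrite big_ord_recr -IHi ?(ltnW lti) //= /height (take_nth D) // /f.
by rewrite -cats1 !count_cat /=; case: (nth D w i) => /=; lia.
Qed.

Lemma atom_rankE (a : zatom) :
  atom_rank (q := zeta_wrp) a = const_mx (atom_level a).
Proof.
case: a => c x; apply/rowP => j; rewrite /atom_rank /rank_eval big_ord1 !mxE.
rewrite addr0 /prefix_rank summxE addrC; congr (_ + _).
rewrite height_sum; last exact: ltnW.
by apply: eq_bigr => k _; rewrite mxE.
Qed.

Lemma lex_lt1 (x y : int) : @lex_lt 1 (const_mx x) (const_mx y) = (x < y).
Proof.
apply/existsP/idP => [[i /andP[_]]|ltxy]; first by rewrite !mxE.
by exists ord0; rewrite !mxE ltxy andbT; apply/forallP => j; rewrite ord1.
Qed.

Lemma wrp_precE (a a' : zatom) : wrp_prec (q := zeta_wrp) a a' =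
  (atom_level a < atom_level a') || (atom_level a == atom_level a') && chi a a'.
Proof.
rewrite /wrp_prec !atom_rankE lex_lt1; congr (_ || (_ && _)).
by apply/eqP/eqP => [/rowP/(_ ord0)|->]; rewrite ?mxE.
Qed.

Lemma atom_eq (a a' : zatom) :
  (a == a') = (atom_pos a == atom_pos a' :> nat) && (atom_copy a == atom_copy a').
Proof.
apply/eqP/andP => [->//|[/eqP/val_inj ep /eqP ec]].
by rewrite -[a]AtomK -[a']AtomK ep ec.
Qed.

Lemma chi_linear : strict_linear_on (selected zeta_base w) (@chi _ _ zeta_base w).
Proof.
split=> [a _|a b c _ _ _|a b _ _].
- by rewrite chiE ltnn eqxx; case: (atom_copy a).
- rewrite !chiE -!val_eqE /=.
  by case: (atom_copy a) (atom_copy b) (atom_copy c) => [] [] []; lia.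
- rewrite atom_eq !chiE -!val_eqE /=.
  by case: (atom_copy a) (atom_copy b) => [] []; lia.
Qed.

Lemma wrp_prec_linear :
  strict_linear_on (selected zeta_base w) (@wrp_prec _ _ zeta_wrp w).
Proof.
have [irr tr tot] := chi_linear.
split=> [a Sa|a b c Sa Sb Sc|a b Sa Sb nab]; rewrite !wrp_precE.
- by rewrite ltxx (negbTE (irr _ Sa)) andbF.
- move=> /orP[lab|/andP[/eqP lab ab]] /orP[lbc|/andP[/eqP lbc bc]].
  + by rewrite (lt_trans lab lbc).
  + by rewrite -lbc lab.
  + by rewrite lab lbc.
  + by rewrite lab lbc eqxx (tr a b c) ?orbT.
- by have := tot _ _ Sa Sb nab; case: ltgtP.
Qed.

(** The scan of [zeta_level], keeping atoms instead of their labels. *)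
Definition level_atoms (s : seq (pos w)) (r : nat) : seq zatom :=
  pmap (fun i : pos w => if height w i == r%:Z then Some (Atom i true)
                 else if height w i == r%:Z - 1 then Some (Atom i false)
                 else None) s.

Lemma mem_level_atoms s r a :
  (a \in level_atoms s r) = (atom_pos a \in s) && (atom_level a == r%:Z).
Proof.
rewrite mem_pmap; apply/mapP/andP => [[i si]|[sa /eqP ea]].
  case: eqP => [e [->]|_]; last case: eqP => // e [->].
    by rewrite /atom_level /atom_pos /atom_copy /= (tnth_nth i) /= e addr0.
  by rewrite /atom_level /atom_pos /atom_copy /= (tnth_nth i) /= e subrK.
exists (atom_pos a) => //; rewrite -{1}[a]AtomK.
move: ea; rewrite /atom_level; case: (atom_copy a) => /= ea.
  by rewrite -ea addr0 eqxx.
by rewrite -ea addrK eqxx; case: eqP => //; lia.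
Qed.

Lemma level_atoms_pairwise (s : seq (pos w)) r :
  pairwise (fun i j : pos w => i < j)%N s ->
  pairwise (@wrp_prec _ _ zeta_wrp w) (level_atoms s r).
Proof.
elim: s => //= i s IHs /andP[/allP lti /IHs pw].
have lt_all c : atom_level (Atom i c) = r%:Z ->
    all (@wrp_prec _ _ zeta_wrp w (Atom i c)) (level_atoms s r).
  move=> e; apply/allP => a; rewrite mem_level_atoms => /andP[sa /eqP ea].
  by rewrite wrp_precE e ea eqxx chiE [(_ < _)%N](lti _ sa) orbT.
rewrite /level_atoms /=; case: eqP => [e|_]; last case: eqP => [e|_] //.
  by rewrite /= [X in _ && X]pw andbT lt_all // /atom_level /atom_pos /= addr0.
by rewrite /= [X in _ && X]pw andbT lt_all // /atom_level /atom_pos /= e subrK.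
Qed.

Definition all_level_atoms (s : seq (pos w)) (m n : nat) : seq zatom :=
  flatten [seq level_atoms s r | r <- iota m n].

Lemma mem_all_level_atoms s m n a :
  (a \in all_level_atoms s m n) =
  (atom_pos a \in s) && (m%:Z <= atom_level a < (m + n)%:Z).
Proof.
apply/flatten_mapP/andP => [[r]|[sa /andP[lem ltn]]].
  rewrite mem_iota mem_level_atoms => rb /andP[-> /eqP->]; split=> //; lia.
exists `|atom_level a|%N; first by rewrite mem_iota; lia.
rewrite mem_level_atoms sa; lia.
Qed.

(** Atoms on different levels are ordered by rank, atoms on the same level by
    position. *)
Lemma all_level_atoms_pairwise (s : seq (pos w)) m n :
  pairwise (fun i j : pos w => i < j)%N s ->
  pairwise (@wrp_prec _ _ zeta_wrp w) (all_level_atoms s m n).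
Proof.
move=> pw; elim: n m => //= n IHn m.
rewrite /all_level_atoms /= pairwise_cat level_atoms_pairwise //.
rewrite [X in _ && X]IHn andbT; apply/allrelP => a b.
rewrite mem_level_atoms -/(all_level_atoms _ _ _) mem_all_level_atoms wrp_precE.
by move=> /andP[_ /eqP ->] /andP[_ /andP[ltm _]]; apply/orP; left; lia.
Qed.

Definition up_positions : seq (pos w) := [seq i <- enum (pos w) | letter i == U].

Lemma up_positions_pairwise :
  pairwise (fun i j : pos w => i < j)%N up_positions.
Proof.
apply: pairwise_filter; rewrite -(pairwise_map val ltn) val_enum_ord.
by rewrite -(sorted_pairwise ltn_trans) iota_ltn_sorted.
Qed.

Lemma area_up_positions : area w = [seq height w i | i : pos w <- up_positions].
Proof.
rewrite /area -val_enum_ord filter_map -map_comp /up_positions.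
by congr map; apply: eq_filter => i; rewrite /= /letter (tnth_nth D).
Qed.

Lemma labels_level_atoms r :
  pmap (fun a : zatom => [pick b | has_label a b]) (level_atoms up_positions r)
  = zeta_level (area w) r.
Proof.
have pickE i c : [pick b | has_label (Atom i c) b] = Some (copy_label c).
  case: pickP => [b|/(_ (copy_label c))]; rewrite has_labelE ?eqxx //.
  by move/eqP->.
rewrite area_up_positions /zeta_level /level_atoms.
elim: up_positions => //= i s IHs.
by case: ifP => _; last case: ifP => _; rewrite /= ?pickE /= IHs.
Qed.

Lemma labels_all_level_atoms m n :
  pmap (fun a : zatom => [pick b | has_label a b])
    (all_level_atoms up_positions m n)
  = flatten [seq zeta_level (area w) r | r <- iota m n].
Proof.
elim: n m => //= n IHn m; rewrite -IHn -labels_level_atoms.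
by rewrite -pmap_cat.
Qed.

Lemma le_area_max (s : seq int) x : x \in s -> x <= (area_max s)%:Z.
Proof.
move=> sx; have ge0 : 0 <= foldr Num.max 0 s.
  by elim: s {sx} => //= y s IHs; rewrite le_max IHs orbT.
rewrite /area_max gez0_abs //; elim: s sx {ge0} => //= y s IHs.
by rewrite in_cons le_max => /predU1P[->|/IHs->]; rewrite ?lexx ?orbT.
Qed.

(** The Dyck condition enters through the lower bound on the heights: the
    letter [U] of a step starting below 0 would be selected but written on no
    level. *)
Lemma zeta_wrp_output : is_dyck w -> output (@wrp_prec _ _ zeta_wrp w) = zeta w.
Proof.
move=> [n /and4P[_ _ _ /forallP ge0]].
rewrite zetaE -labels_all_level_atoms /output; congr pmap.
apply: sort_strict_linear_unique => [||a].
- exact: wrp_prec_linear.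
- exact/all_level_atoms_pairwise/up_positions_pairwise.
rewrite mem_all_level_atoms selectedE mem_filter mem_enum andbT.
case: eqP => // ea; rewrite andTb add0n.
have h0 : 0 <= height w (atom_pos a).
  exact: (ge0 (widen_ord (leqnSn _) (atom_pos a))).
have hm : height w (atom_pos a) <= (area_max (area w))%:Z.
  apply: le_area_max; rewrite area_up_positions; apply/mapP.
  by exists (atom_pos a); rewrite // mem_filter ea eqxx mem_enum.
by rewrite /atom_level; case: (atom_copy a) => /=; lia.
Qed.

End Word.

Lemma zeta_is_wrp :
  is_wrp (wrp_map zeta_wrp) /\
  forall P, is_dyck P -> wrp_map zeta_wrp P = Some (zeta P).
Proof.
split=> [|P dP]; last first.
  rewrite /wrp_map /models /holds /= -zeta_wrp_output //.
  by case: ifP => // /negP[]; apply/forallP => i; rewrite eqxx.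
exists zeta_wrp; split=> //; split.
- by rewrite card_bool.
- by [].
- move=> w a _; exists (copy_label (atom_copy a)).
  by split=> [|b]; rewrite has_labelE // => /eqP.
- exact: chi_linear.
Qed.

End ZetaWrp.

Theorem theorem1p1 :
  (exists Z : word_map step step,
     is_wrp Z /\ forall P : seq step, is_dyck P -> Z P = Some (zeta P)) /\
  ~ (exists T : word_map step step,
       polyregular T /\ forall P : seq step, is_dyck P -> T P = Some (zeta P)).
Proof.
split; first by exists (wrp_map zeta_wrp); exact: zeta_is_wrp.
by move=> [T [/zeta_not_polyregular]].
Qed.
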